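(* Let $\mathcal{A}\in\mathbb{R}^{m\times p\times n}$ and let $Q\in\mathbb{R}^{m\times m}$, $W\in\mathbb{R}^{p\times p}$, $Z\in\mathbb{R}^{n\times n}$ be the orthogonal HOSVD factor matrices of $\mathcal{A}$. Let $\mathbf{k}=(k_1,k_2,k_3)$ with $k_1\le m$, $k_2\le p$, $k_3\le n$, and let $\mathcal{A}_{\mathbf{k}}$ be the corresponding truncated HOSVD approximation. Set $M=Z^\top$ (so $M^{-1}=Z$), and define tensors $\mathcal{Q}\in\mathbb{R}^{m\times m\times n}$, $\mathcal{W}\in\mathbb{R}^{p\times p\times n}$ by $\widehat{\mathcal{Q}}_{:,:,i}=Q$, $\widehat{\mathcal{W}}_{:,:,i}=W$ for $i=1,\dots,n$, i.e. $\mathcal{Q}=\widehat{\mathcal{Q}}\times_3M^{-1}$, $\mathcal{W}=\widehat{\mathcal{W}}\times_3M^{-1}$. Then $\mathcal{Q}$ and $\mathcal{W}$ are $\star_M$-unitary tensors. Let $\mathcal{P}$ be the $p\times p\times n$ tensor such that $\widehat{\mathcal{P}}_{:,:,i}$ is the identity matrix for $1\le i\le k_3$ and the zero matrix for $k_3+1\le i\le n$, and let $\mathcal{C}=\mathcal{Q}_{:,1:k_1,:}^\top\star_M\mathcal{A}\star_M\mathcal{W}_{:,1:k_2,:}$. Then $$\mathcal{A}_{\mathbf{k}}=\mathcal{Q}_{:,1:k_1,:}\star_M\mathcal{C}\star_M\mathcal{W}_{:,1:k_2,:}^\top\star_M\mathcal{P}.$$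
   Context: MATLAB index notation is used. Mode products: for a tensor $\mathcal{A}$ and matrix $F$ of compatible size, $(\mathcal{A}\times_1F)_{a,j,k}=\sum_iF_{ai}\mathcal{A}_{i,j,k}$, $(\mathcal{A}\times_2F)_{i,b,k}=\sum_jF_{bj}\mathcal{A}_{i,j,k}$, $(\mathcal{A}\times_3F)_{i,j,c}=\sum_kF_{ck}\mathcal{A}_{i,j,k}$. HOSVD: $Q,W,Z$ are the (full, orthogonal) matrices of left singular vectors of the mode-1, mode-2 and mode-3 unfoldings $\mathcal{A}_{(1)}$ ($m\times pn$), $\mathcal{A}_{(2)}$ ($p\times mn$), $\mathcal{A}_{(3)}$ ($n\times mp$) of $\mathcal{A}$ (the matrices whose columns are the mode-1, mode-2, mode-3 fibers), ordered by non-increasing singular values. Truncated HOSVD: the core is $\mathcal{C}_{\mathbf{k}}=\mathcal{A}\times_1Q_{:,1:k_1}^\top\times_2W_{:,1:k_2}^\top\times_3Z_{:,1:k_3}^\top$ and $\mathcal{A}_{\mathbf{k}}=\mathcal{C}_{\mathbf{k}}\times_1Q_{:,1:k_1}\times_2W_{:,1:k_2}\times_3Z_{:,1:k_3}$. For an invertible $n\times n$ matrix $M$, $\widehat{\mathcal{A}}=\mathcal{A}\times_3M$. The product $\mathcal{C}=\mathcal{A}\star_M\mathcal{B}$ is defined by $\widehat{\mathcal{C}}_{:,:,i}=\widehat{\mathcal{A}}_{:,:,i}\widehat{\mathcal{B}}_{:,:,i}$ ($i=1,\dots,n$), $\mathcal{C}=\widehat{\mathcal{C}}\times_3M^{-1}$.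 The transpose under $\star_M$ (real case) is defined by $(\widehat{\mathcal{A}^\top})_{:,:,i}=(\widehat{\mathcal{A}}_{:,:,i})^\top$. The identity tensor $\mathcal{I}$ has every $\widehat{\mathcal{I}}_{:,:,i}$ equal to the identity matrix, and $\mathcal{Q}$ is $\star_M$-unitary (orthogonal) if $\mathcal{Q}^\top\star_M\mathcal{Q}=\mathcal{I}=\mathcal{Q}\star_M\mathcal{Q}^\top$. *)

(* Defs.v *)
From mathcomp Require Import all_boot all_order all_algebra.
From mathcomp Require Import reals.

Set Implicit Arguments.
Unset Strict Implicit.
Unset Printing Implicit Defensive.

Import Order.TTheory GRing.Theory Num.Theory.

Local Open Scope ring_scope.

Definition tensor (R : realType) (m p n : nat) : Type :=
  {ffun 'I_m * 'I_p * 'I_n -> R}.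

(* The frontal slice A_{:,:,k}. *)
Definition slice (R : realType) (m p n : nat) (A : tensor R m p n) (k : 'I_n) :
    'M[R]_(m, p) :=
  \matrix_(i < m, j < p) A (i, j, k).

Definition of_slices (R : realType) (m p n : nat) (F : 'I_n -> 'M[R]_(m, p)) :
    tensor R m p n :=
  [ffun x : 'I_m * 'I_p * 'I_n => F x.2 x.1.1 x.1.2].

Definition mode1 (R : realType) (m p n q : nat) (A : tensor R m p n)
    (F : 'M[R]_(q, m)) : tensor R q p n :=
  [ffun x : 'I_q * 'I_p * 'I_n =>
     \sum_(i < m) F x.1.1 i * A (i, x.1.2, x.2)].

Definition mode2 (R : realType) (m p n q : nat) (A : tensor R m p n)
    (F : 'M[R]_(q, p)) : tensor R m q n :=
  [ffun x : 'I_m * 'I_q * 'I_n =>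
     \sum_(j < p) F x.1.2 j * A (x.1.1, j, x.2)].

Definition mode3 (R : realType) (m p n q : nat) (A : tensor R m p n)
    (F : 'M[R]_(q, n)) : tensor R m p q :=
  [ffun x : 'I_m * 'I_p * 'I_q =>
     \sum_(k < n) F x.2 k * A (x.1.1, x.1.2, k)].

Notation "A '\x_1' F" := (mode1 A F) (at level 40, left associativity).
Notation "A '\x_2' F" := (mode2 A F) (at level 40, left associativity).
Notation "A '\x_3' F" := (mode3 A F) (at level 40, left associativity).

(* Unfoldings: the columns are the mode-d fibers.  They are listed in the
   row-major order of mxvec; the left singular vectors and singular values do
   not depend on the order of the columns. *)
Definition unfold1 (R : realType) (m p n : nat) (A : tensor R m p n) :
    'M[R]_(m, p * n) :=
  \matrix_(i < m) mxvec (\matrix_(j < p, k < n) A (i, j, k)).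

Definition unfold2 (R : realType) (m p n : nat) (A : tensor R m p n) :
    'M[R]_(p, m * n) :=
  \matrix_(j < p) mxvec (\matrix_(i < m, k < n) A (i, j, k)).

Definition unfold3 (R : realType) (m p n : nat) (A : tensor R m p n) :
    'M[R]_(n, m * p) :=
  \matrix_(k < n) mxvec (\matrix_(i < m, j < p) A (i, j, k)).

Definition orthogonal_mx (R : realType) (m : nat) (U : 'M[R]_m) : Prop :=
  U^T *m U = 1%:M /\ U *m U^T = 1%:M.

(* S is the rectangular diagonal factor of a full SVD; for i = j (as numbers)
   the entry S i j is the i-th singular value. *)
Definition singular_value_mx (R : realType) (m N : nat) (S : 'M[R]_(m, N)) :
    Prop :=
  [/\ is_diag_mx S,
      forall (i : 'I_m) (j : 'I_N), i = j :> nat -> 0 <= S i j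
    & forall (i i' : 'I_m) (j j' : 'I_N),
        i = j :> nat -> i' = j' :> nat -> (i <= i')%N -> S i' j' <= S i j].

(* U is the U-factor of some full SVD X = U S V^T. *)
Definition left_singular_mx (R : realType) (m N : nat) (X : 'M[R]_(m, N))
    (U : 'M[R]_m) : Prop :=
  orthogonal_mx U /\
  exists (S : 'M[R]_(m, N)) (V : 'M[R]_N),
    [/\ singular_value_mx S, orthogonal_mx V & X = U *m S *m V^T].

(* Singular vectors are not unique, so being a triple of HOSVD factor matrices
   of A is a relation. *)
Definition hosvd_factors (R : realType) (m p n : nat) (A : tensor R m p n)
    (Q : 'M[R]_m) (W : 'M[R]_p) (Z : 'M[R]_n) : Prop :=
  [/\ left_singular_mx (unfold1 A) Q,
      left_singular_mx (unfold2 A) W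
    & left_singular_mx (unfold3 A) Z].

(* The columns Q_{:,1:k}. *)
Definition first_cols (R : realType) (r m k : nat) (hk : (k <= m)%N)
    (Q : 'M[R]_(r, m)) : 'M[R]_(r, k) :=
  colsub (widen_ord hk) Q.

Definition hosvd_core (R : realType) (m p n k1 k2 k3 : nat)
    (hk1 : (k1 <= m)%N) (hk2 : (k2 <= p)%N) (hk3 : (k3 <= n)%N)
    (Q : 'M[R]_m) (W : 'M[R]_p) (Z : 'M[R]_n) (A : tensor R m p n) :
    tensor R k1 k2 k3 :=
  A \x_1 (first_cols hk1 Q)^T \x_2 (first_cols hk2 W)^T
    \x_3 (first_cols hk3 Z)^T.

Definition truncated_hosvd (R : realType) (m p n k1 k2 k3 : nat)
    (hk1 : (k1 <= m)%N) (hk2 : (k2 <= p)%N) (hk3 : (k3 <= n)%N)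
    (Q : 'M[R]_m) (W : 'M[R]_p) (Z : 'M[R]_n) (A : tensor R m p n) :
    tensor R m p n :=
  hosvd_core hk1 hk2 hk3 Q W Z A
    \x_1 first_cols hk1 Q \x_2 first_cols hk2 W \x_3 first_cols hk3 Z.

Definition hat (R : realType) (m p n : nat) (M : 'M[R]_n) (A : tensor R m p n) :
    tensor R m p n :=
  A \x_3 M.

(* For invertible M, the tensor A with (hat M A)_{:,:,i} = F i for all i. *)
Definition of_hat (R : realType) (m p n : nat) (M : 'M[R]_n)
    (F : 'I_n -> 'M[R]_(m, p)) : tensor R m p n :=
  of_slices F \x_3 invmx M.

(* The operations below are meant for M \in unitmx. *)
Definition starM (R : realType) (m p l n : nat) (M : 'M[R]_n)
    (A : tensor R m p n) (B : tensor R p l n) : tensor R m l n :=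
  of_hat M (fun i => slice (hat M A) i *m slice (hat M B) i).

Notation "A '*t[' M ] B" := (starM M A B)
  (at level 40, left associativity, format "A  *t[ M ]  B").

Definition trM (R : realType) (m p n : nat) (M : 'M[R]_n) (A : tensor R m p n) :
    tensor R p m n :=
  of_hat M (fun i => (slice (hat M A) i)^T).

Definition idM (R : realType) (m n : nat) (M : 'M[R]_n) : tensor R m m n :=
  of_hat M (fun=> 1%:M).

Definition starM_unitary (R : realType) (m n : nat) (M : 'M[R]_n)
    (A : tensor R m m n) : Prop :=
  trM M A *t[M] A = idM m M /\ A *t[M] trM M A = idM m M.

(* The subtensor A_{:,1:k,:}. *)
Definition first_lateral (R : realType) (m p n k : nat) (hk : (k <= p)%N)
    (A : tensor R m p n) : tensor R m k n :=
  [ffun x : 'I_m * 'I_k * 'I_n => A (x.1.1, widen_ord hk x.1.2, x.2)].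

(* Main.v *)
Require Import Defs.
From mathcomp Require Import all_boot all_order all_algebra.
From mathcomp Require Import reals.

Set Implicit Arguments.
Unset Strict Implicit.
Unset Printing Implicit Defensive.

Import Order.TTheory GRing.Theory Num.Theory.
Local Open Scope ring_scope.

(** Two tensors agree as soon as their slices in the transform domain agree,
    and there every operation is matrix algebra: [starM] is a slicewise
    product, [trM] a slicewise transpose, and [mode1], [mode2] multiply each
    slice on the left and on the right ([slice_mode1], [slice_mode2]).
    Since mode-3 products commute with the other two ([mode3_mode1],
    [mode3_mode2]) and compose like matrices ([mode3_mode3]), the truncated
    HOSVD is a compression in modes 1 and 2 of the tensor obtained from [A] by
    the mode-3 product with [Zk *m Zk^T], where [Qk], [Wk] and [Zk]
    consist of the leading columns of [Q], [W] and [Z].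

    The choice [M = Z^T] turns this mode-3 projection into a truncation.  As
    the columns of [Z] are orthonormal, [Z^T *m Zk *m Zk^T] is [Z^T] with its
    rows after the first [k3] replaced by zero
    ([tr_orthogonal_first_cols_proj]), so the projection keeps the first [k3]
    transformed slices and kills the others.  This is exactly right
    multiplication by the slices of [P].  Hence the [i]-th transformed slice
    of each side is [Qk *m Qk^T *m Ai *m Wk *m Wk^T], with [Ai] the [i]-th
    transformed slice of [A], or zero, according to whether [i < k3].

    The unitarity of the two constant tensors is, slice by slice, the
    orthogonality of [Q] and [W]. *)

Lemma slice_inj (R : realType) (m p n : nat) (A B : tensor R m p n) :
  (forall k, slice A k = slice B k) -> A = B.
Proof.
move=> eqAB; apply/ffunP=> -[[i j] k].
by have /matrixP/(_ i j) := eqAB k; rewrite !mxE.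
Qed.

Lemma slice_of_slices (R : realType) (m p n : nat) (F : 'I_n -> 'M[R]_(m, p))
    (k : 'I_n) :
  slice (of_slices F) k = F k.
Proof. by apply/matrixP=> i j; rewrite mxE ffunE. Qed.

Lemma slice_mode1 (R : realType) (m p n q : nat) (A : tensor R m p n)
    (F : 'M[R]_(q, m)) (k : 'I_n) :
  slice (A \x_1 F) k = F *m slice A k.
Proof.
apply/matrixP=> i j; rewrite !mxE ffunE.
by apply: eq_bigr => l _; rewrite mxE.
Qed.

Lemma slice_mode2 (R : realType) (m p n q : nat) (A : tensor R m p n)
    (F : 'M[R]_(q, p)) (k : 'I_n) :
  slice (A \x_2 F) k = slice A k *m F^T.
Proof.
apply/matrixP=> i j; rewrite !mxE ffunE.
by apply: eq_bigr => l _; rewrite !mxE mulrC.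
Qed.

Lemma slice_mode3 (R : realType) (m p n q : nat) (A : tensor R m p n)
    (F : 'M[R]_(q, n)) (c : 'I_q) :
  slice (A \x_3 F) c = \sum_k F c k *: slice A k.
Proof.
apply/matrixP=> i j; rewrite mxE ffunE summxE.
by apply: eq_bigr => l _; rewrite !mxE.
Qed.

Lemma mode3_mode1 (R : realType) (m p n q r : nat) (A : tensor R m p n)
    (F : 'M[R]_(q, m)) (G : 'M[R]_(r, n)) :
  A \x_1 F \x_3 G = A \x_3 G \x_1 F.
Proof.
apply: slice_inj => c; rewrite slice_mode1 !slice_mode3 mulmx_sumr.
by apply: eq_bigr => k _; rewrite slice_mode1 scalemxAr.
Qed.

Lemma mode3_mode2 (R : realType) (m p n q r : nat) (A : tensor R m p n)
    (F : 'M[R]_(q, p)) (G : 'M[R]_(r, n)) :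
  A \x_2 F \x_3 G = A \x_3 G \x_2 F.
Proof.
apply: slice_inj => c; rewrite slice_mode2 !slice_mode3 mulmx_suml.
by apply: eq_bigr => k _; rewrite slice_mode2 scalemxAl.
Qed.

Lemma mode3_mode3 (R : realType) (m p n q r : nat) (A : tensor R m p n)
    (F : 'M[R]_(q, n)) (G : 'M[R]_(r, q)) :
  A \x_3 F \x_3 G = A \x_3 (G *m F).
Proof.
apply: slice_inj => c; rewrite !slice_mode3.
under eq_bigr do rewrite slice_mode3 scaler_sumr.
rewrite exchange_big; apply: eq_bigr => k _ /=.
by rewrite mxE scaler_suml; apply: eq_bigr => l _; rewrite scalerA.
Qed.

Lemma mode3_1 (R : realType) (m p n : nat) (A : tensor R m p n) :
  A \x_3 1%:M = A.
Proof.
apply: slice_inj => c; rewrite slice_mode3 (bigD1 c) //= mxE eqxx scale1r.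
by rewrite big1 ?addr0 // => k neq_kc; rewrite mxE eq_sym (negPf neq_kc) scale0r.
Qed.

Lemma slice_hat_of_hat (R : realType) (m p n : nat) (M : 'M[R]_n)
    (F : 'I_n -> 'M[R]_(m, p)) (i : 'I_n) :
  M \in unitmx -> slice (hat M (of_hat M F)) i = F i.
Proof.
by move=> unitM; rewrite /hat mode3_mode3 mulmxV // mode3_1 slice_of_slices.
Qed.

Lemma hat_slice_inj (R : realType) (m p n : nat) (M : 'M[R]_n)
    (A B : tensor R m p n) :
  M \in unitmx ->
  (forall i, slice (hat M A) i = slice (hat M B) i) -> A = B.
Proof.
move=> unitM /slice_inj eqAB; rewrite -[A]mode3_1 -[B]mode3_1 -(mulVmx unitM).
by rewrite -!mode3_mode3 -!/(hat M _) eqAB.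
Qed.

Lemma slice_hat_starM (R : realType) (m p l n : nat) (M : 'M[R]_n)
    (A : tensor R m p n) (B : tensor R p l n) (i : 'I_n) :
  M \in unitmx ->
  slice (hat M (A *t[M] B)) i = slice (hat M A) i *m slice (hat M B) i.
Proof. exact: slice_hat_of_hat. Qed.

Lemma slice_hat_trM (R : realType) (m p n : nat) (M : 'M[R]_n)
    (A : tensor R m p n) (i : 'I_n) :
  M \in unitmx ->
  slice (hat M (trM M A)) i = (slice (hat M A) i)^T.
Proof. exact: slice_hat_of_hat. Qed.

Lemma starM_unitary_const (R : realType) (m n : nat) (M : 'M[R]_n)
    (U : 'M[R]_m) :
  M \in unitmx -> orthogonal_mx U -> starM_unitary M (of_hat M (fun=> U)).
Proof.
by move=> unitM [UtU UUt]; split; apply: (hat_slice_inj unitM) => i;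
  rewrite slice_hat_starM // slice_hat_trM // !slice_hat_of_hat.
Qed.

(** Taking leading lateral slices acts on mode 2 only, hence commutes with the
    transform along mode 3. *)
Lemma slice_hat_first_lateral (R : realType) (m p n k : nat) (M : 'M[R]_n)
    (hk : (k <= p)%N) (A : tensor R m p n) (i : 'I_n) :
  slice (hat M (first_lateral hk A)) i = first_cols hk (slice (hat M A) i).
Proof.
apply/matrixP=> a b; rewrite !mxE !ffunE /=.
by apply: eq_bigr => l _; rewrite ffunE.
Qed.

(** Write the leading columns as [Z *m E], with [E] the leading columns of the
    identity: [Z^T *m Z] cancels, and [E *m E^T] is the coordinate projection
    on the first [k] coordinates. *)
Lemma tr_orthogonal_first_cols_proj (R : realType) (n k : nat) (hk : (k <= n)%N)
    (Z : 'M[R]_n) (i j : 'I_n) :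
  Z^T *m Z = 1%:M ->
  (Z^T *m first_cols hk Z *m (first_cols hk Z)^T) i j =
    if (i < k)%N then Z^T i j else 0.
Proof.
move=> ZtZ; have -> : Z^T *m first_cols hk Z = first_cols hk 1%:M.
  by rewrite /first_cols mulmx_colsub ZtZ.
rewrite mxE; case: ltnP => [lt_ik | le_ki].
  rewrite (bigD1 (Ordinal lt_ik)) //= big1 ?addr0 => [|l neq_l].
    rewrite !mxE; have -> : widen_ord hk (Ordinal lt_ik) = i by apply: val_inj.
    by rewrite eqxx mul1r.
  rewrite !mxE (_ : (i == _) = false) ?mul0r //.
  by apply: contraNF neq_l => /eqP eq_i; apply/eqP/val_inj; rewrite /= eq_i.
rewrite big1 // => l _; rewrite !mxE (_ : (i == _) = false) ?mul0r //.
apply/negP=> /eqP eq_i; have := ltn_ord l.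
by rewrite ltnNge -[nat_of_ord l]/(nat_of_ord (widen_ord hk l)) -eq_i le_ki.
Qed.

Lemma slice_hat_truncated_hosvd (R : realType) (m p n k1 k2 k3 : nat)
    (hk1 : (k1 <= m)%N) (hk2 : (k2 <= p)%N) (hk3 : (k3 <= n)%N)
    (Q : 'M[R]_m) (W : 'M[R]_p) (Z : 'M[R]_n) (A : tensor R m p n) (i : 'I_n) :
  Z^T *m Z = 1%:M ->
  slice (hat Z^T (truncated_hosvd hk1 hk2 hk3 Q W Z A)) i =
    if (i < k3)%N then
      first_cols hk1 Q *m
        ((first_cols hk1 Q)^T *m slice (hat Z^T A) i *m first_cols hk2 W) *m
        (first_cols hk2 W)^T
    else 0.
Proof.
move=> ZtZ; rewrite /hat /truncated_hosvd /hosvd_core.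
(* Bring all the mode-3 products next to A, and merge them. *)
rewrite !(mode3_mode1, mode3_mode2) !mode3_mode3.
rewrite !(slice_mode1, slice_mode2) trmxK !slice_mode3.
under eq_bigr do rewrite tr_orthogonal_first_cols_proj //.
case: ifP => // _; rewrite big1 ?(mulmx0, mul0mx) // => k _.
by rewrite scale0r.
Qed.

Theorem theorem7p1 (R : realType) (m p n : nat) (A : tensor R m p n)
    (Q : 'M[R]_m) (W : 'M[R]_p) (Z : 'M[R]_n)
    (hosvdA : hosvd_factors A Q W Z)
    (k1 k2 k3 : nat)
    (hk1 : (k1 <= m)%N) (hk2 : (k2 <= p)%N) (hk3 : (k3 <= n)%N) :
  let M : 'M[R]_n := Z^T in
  let tQ : tensor R m m n := of_hat M (fun=> Q) in
  let tW : tensor R p p n := of_hat M (fun=> W) in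
  [/\ M \in unitmx /\ invmx M = Z,
      starM_unitary M tQ,
      starM_unitary M tW
    & forall P : tensor R p p n,
        (forall i : 'I_n,
           slice (hat M P) i = if (i < k3)%N then 1%:M else 0) ->
        let C : tensor R k1 k2 n :=
          trM M (first_lateral hk1 tQ) *t[M] A *t[M] first_lateral hk2 tW in
        truncated_hosvd hk1 hk2 hk3 Q W Z A =
        first_lateral hk1 tQ *t[M] C *t[M] trM M (first_lateral hk2 tW)
          *t[M] P].
Proof.
move=> M tQ tW; case: hosvdA => -[orthQ _] [orthW _] [[ZtZ _] _].
have [unitM _] : Z^T \in unitmx /\ Z \in unitmx by exact: mulmx1_unit.
have invM : invmx M = Z by rewrite -[LHS]mulmx1 -ZtZ mulKmx.
split; [by [] | exact: starM_unitary_const | exact: starM_unitary_const |].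
move=> P hatP C; apply: (hat_slice_inj unitM) => i.
rewrite slice_hat_truncated_hosvd //.
rewrite !(slice_hat_starM, slice_hat_trM) // hatP.
rewrite !slice_hat_first_lateral !slice_hat_of_hat //.
by case: ifP => _; rewrite ?mulmx1 ?mulmx0.
Qed.
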